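(* Let $G$ be a finite group and let $f(G)=\frac{m(G)}{|G|^2}$, where $m(G)=\max\{|H|\,|C_G(H)| : H\leq G\}$. The following hold: 1. If $f(G)>\frac{1}{4}$, then $G$ is abelian. Moreover, $f(G)=\frac{1}{4}$ if and only if $G$ has a self-centralizing subgroup of index $2$. 2. If $f(G)>\frac{1}{9}$, then $G$ is supersolvable. Moreover, if $f(G)=\frac{1}{9}$, then $G$ has a self-centralizing subgroup of index $3$. 3. If $f(G)>\frac{1}{60}$, then $G$ is solvable. Moreover, $f(G)=\frac{1}{60}$ if and only if $G/Z(G)\cong A_5$.
   Context: For a finite group $G$ and a subgroup $H\leq G$, $C_G(H)$ denotes the centralizer of $H$ in $G$, and the Chermak-Delgado measure of $H$ is $m_G(H)=|H|\,|C_G(H)|$. The Chermak-Delgado measure of $G$ is $m(G)=\max\{m_G(H) : H\leq G\}$, and $f(G)=\frac{m(G)}{|G|^2}$. A subgroup $H$ of $G$ is self-centralizing if $C_G(H)=H$. $Z(G)$ is the center of $G$, and $A_5$ is the alternating group of degree $5$. *)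

(* Defs.v *)
From mathcomp Require Import all_boot all_order all_algebra.
From mathcomp Require Import all_fingroup all_solvable.

Set Implicit Arguments.
Unset Strict Implicit.
Unset Printing Implicit Defensive.

Import Order.TTheory GRing.Theory Num.Theory.

Local Open Scope ring_scope.

Section ChermakDelgado.

Variable gT : finGroupType.
Implicit Types G H K : {group gT}.

Definition cd_measure G H : nat := (#|H| * #|'C_G(H)%g|)%N.

Definition cd_max G : nat :=
  (\max_(H : {group gT} | H \subset G) cd_measure G H)%N.

Definition cd_ratio G : rat := (cd_max G)%:R / (#|G| ^ 2)%N%:R.

Definition self_centralizing G H : bool :=
  (H \subset G) && ('C_G(H)%g == H :> {set gT}).

(* Every term of the chain from 1 to G is normal in the whole group G, not
   just in the next term. *)
Definition supersolvable G : Prop :=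
  exists2 s : seq {group gT},
    path (fun H K : {group gT} =>
            [&& (H <| G)%g, (K <| G)%g, H \subset K & cyclic (K / H)%g])
         1%G s
    & last 1%G s = G.

End ChermakDelgado.

(* Main.v *)
(* Let H attain the maximum of |H||C_G(H)| and put M = H C_G(H). Since
   H :&: C_G(H) centralizes M, M attains the maximum as well, and now
   C_G(M) = Z(M). Hence 1 / f(G) = d ^ 2 * e with d = |G : M| and
   e = |M : Z(M)|, and M / Z(M) is cyclic only if e = 1.
   Each assertion follows by listing the pairs (d, e).
   - If 1 / f(G) < 9, then |G : Z(G)| <= 8 or M is abelian of index 2; both
     conditions pass to quotients and provide a nontrivial cyclic normal
     subgroup.
   - If 1 / f(G) < 60, then |G : Z(G)| < 60, or M is solvable of index at most
     4, or M is abelian of index at most 7. Groups of order less than 60 are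
     solvable by Burnside's p^a q^b theorem, up to the orders 30 and 42. In the
     last case, for a conjugate M^x of M other than M, M :&: M^x is central in
     <M, M^x>, which has a center of index at most 49 if it is G, and otherwise
     splits the index of M into factors at most 3.
   - If 1 / f(G) = 60, then (d, e) = (1, 60), as (2, 15) would make M / Z(M)
     cyclic. When G is solvable, a Hall subgroup of order 15 of G / Z(G) lifts
     to an abelian subgroup whose square is too large. A nonsolvable group of
     order 60 has a subgroup of index 5: otherwise it has 15 Sylow 2-subgroups
     with trivial intersections, so that one of them is a Frobenius complement,
     whose kernel is normal. *)
Require Import Defs.
From mathcomp Require Import all_boot all_order all_algebra.
From mathcomp Require Import all_fingroup all_solvable.
From mathcomp Require Import integral_char vcharacter ring zify.

Set Implicit Arguments.
Unset Strict Implicit.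
Unset Printing Implicit Defensive.

Import Order.TTheory GRing.Theory Num.Theory.

Local Open Scope group_scope.

(** * Permutation representations on cosets *)

Section CosetAction.

Variables (gT : finGroupType) (G H : {group gT}).

Let rcosets_in : gval H \in rcosets H G.
Proof. by apply/rcosetsP; exists 1; rewrite ?group1 ?mulg1. Qed.

Let ract : action G {set gT} := (<[actsRs_rcosets H G]>)%act.

Let ract_in A g : A \in rcosets H G -> ract A g \in rcosets H G.
Proof.
move=> RA; rewrite /= /actby RA /=; case: ifP => // Gg.
by rewrite (acts_act (actsRs_rcosets H G)).
Qed.

(** Numbering the cosets by ordinals makes the target symmetric group depend on the index alone, so
    that index 5 yields permutations of ['I_5]. *)
Let ord_ract (i : 'I_#|G : H|) (g : gT) : 'I_#|G : H| :=
  enum_rank_in rcosets_in (ract (enum_val i) g).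

Let ord_ractE i g : enum_val (ord_ract i g) = ract (enum_val i) g.
Proof. by rewrite enum_rankK_in ?ract_in ?enum_valP. Qed.

Let ord_ract_is_action : is_action G ord_ract.
Proof.
split=> [g i j /(congr1 enum_val)|i g h Gg Gh].
  by rewrite !ord_ractE => /act_inj/enum_val_inj.
by apply: enum_val_inj; rewrite !ord_ractE actMin.
Qed.

(** An element acting trivially fixes the coset [H] itself, hence lies in [H]. *)
Lemma perm_rcosets_morphism :
  H \subset G ->
  exists f : {morphism G >-> {perm 'I_#|G : H|}}, 'ker f \subset H.
Proof.
move=> sHG; exists (actperm_morphism (Action ord_ract_is_action)).
apply/subsetP=> g /morphpreP[Gg] /set1P /permP/(_ (enum_rank_in rcosets_in H)).
rewrite actpermE perm1 => /(congr1 enum_val).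
rewrite /= ord_ractE enum_rankK_in // /= /actby rcosets_in Gg /= => defH.
by rewrite -defH rcosetE rcoset_refl.
Qed.

End CosetAction.

(** * Solvability of groups of order less than 60 *)

(** Such a [P] is a Frobenius complement, and [K] is its Frobenius kernel. *)
Lemma normedTI_normal_complement (gT : finGroupType) (G P : {group gT}) :
    P \proper G -> normedTI P^# G P ->
  exists2 K : {group gT}, K <| G & #|K| = #|G : P|.
Proof.
move=> /andP[sPG not_sGP] tiP.
have neqPG: P :!=: G by rewrite eqEsubset (negPf not_sGP) andbF.
have [|K frobG] := @Frobenius_kernel_exists gT G P; first exact/andP.
have [defG _ _ _ _] := Frobenius_context frobG.
have [nsKG _ _ _ _] := sdprod_context defG.
exists K => //; apply/eqP; rewrite -(eqn_pmul2l (cardG_gt0 P)) Lagrange //.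
by rewrite mulnC (sdprod_card defG).
Qed.

Lemma series_biprimary_sol (gT : finGroupType) (G K : {group gT}) :
    K <| G -> (size (primes #|K|) <= 2)%N -> (size (primes #|G : K|) <= 2)%N ->
  solvable G.
Proof.
move=> nsKG solK solGK; rewrite (series_sol nsKG) !Burnside_p_a_q_b //.
by rewrite card_quotient ?normal_norm.
Qed.

(** Sylow's counting theorem, in the form of a list that can be computed for each concrete order. *)
Lemma index_norm_Sylow_divisors (gT : finGroupType) (G P : {group gT}) p :
    prime p -> p.-Sylow(G) P ->
  #|G : 'N_G(P)| \in [seq d <- divisors #|G : P| | d == 1 %[mod p]].
Proof.
move=> p_pr sylP; rewrite mem_filter -dvdn_divisors ?indexg_gt0 //.
rewrite -(card_Syl sylP) (card_Syl_mod _ p_pr) modn_small ?prime_gt1 //=.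
by rewrite (card_Syl sylP) indexgS // subsetI (pHall_sub sylP) normG.
Qed.

Lemma norm_index1_normal (gT : finGroupType) (G P : {group gT}) :
  P \subset G -> #|G : 'N_G(P)| = 1%N -> P <| G.
Proof.
by move=> sPG /index1g defG; rewrite /normal sPG -{1}defG ?subsetIl ?subsetIr.
Qed.

Lemma card_Sylow_index (gT : finGroupType) (G P : {group gT}) p :
    p.-Sylow(G) P ->
  #|P| = (p ^ logn p #|G|)%N /\ #|G : P| = (#|G| %/ p ^ logn p #|G|)%N.
Proof.
by move=> sylP; rewrite -divgS ?(pHall_sub sylP) // (card_Hall sylP) p_part.
Qed.

(** The Sylow 7-subgroup is normal, with a quotient of order 6. *)
Lemma solvable_card42 (gT : finGroupType) (G : {group gT}) :
  #|G| = 42 -> solvable G.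
Proof.
move=> oG; have [P sylP] := Sylow_exists 7 G.
have [oP iP] := card_Sylow_index sylP.
have {}iP: #|G : P| = 6 by rewrite iP oG; vm_compute.
have {}oP: #|P| = 7 by rewrite oP oG; vm_compute.
have := index_norm_Sylow_divisors _ sylP; rewrite iP => /(_ isT).
have -> : [seq d <- divisors 6 | d == 1 %[mod 7]] = [:: 1%N] by vm_compute.
rewrite inE => /eqP/(norm_index1_normal (pHall_sub sylP)) nsPG.
by apply: series_biprimary_sol nsPG _ _; rewrite ?iP ?oP.
Qed.

(** Either the Sylow 5-subgroup is normal, or it is self-normalizing. In the latter case its prime
    order makes distinct conjugates meet trivially, and a Frobenius kernel of order 6 appears. *)
Lemma solvable_card30 (gT : finGroupType) (G : {group gT}) :
  #|G| = 30 -> solvable G.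
Proof.
move=> oG; have [P sylP] := Sylow_exists 5 G.
have [oP iP] := card_Sylow_index sylP.
have {}iP: #|G : P| = 6 by rewrite iP oG; vm_compute.
have {}oP: #|P| = 5 by rewrite oP oG; vm_compute.
have sPG := pHall_sub sylP.
have := index_norm_Sylow_divisors _ sylP; rewrite iP => /(_ isT).
have -> : [seq d <- divisors 6 | d == 1 %[mod 5]] = [:: 1%N; 6] by vm_compute.
rewrite !inE => /orP[] /eqP iN.
  have nsPG := norm_index1_normal sPG iN.
  by apply: series_biprimary_sol nsPG _ _; rewrite ?iP ?oP.
have defN : 'N_G(P) = P.
  apply/eqP; rewrite eq_sym eqEcard subsetI sPG normG /=.
  by rewrite -(leq_pmul2r (isT : 0 < 6)%N) -{1}iN -iP !Lagrange ?subsetIl.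
have [||K nsKG iK] := @normedTI_normal_complement _ G P.
- by rewrite properEcard sPG oP oG.
- apply/normedTI_P; rewrite normD1 defN subxx setD_eq0 subG1 trivg_card1 oP.
  split=> // g Gg; suff: ~~ [disjoint P^# & P^# :^ g] -> g \in 'N_G(P).
    by rewrite defN.
  rewrite inE Gg -setI_eq0 conjD1g -setDIl setD_eq0; apply: contraR => nPg.
  rewrite prime_TIg ?oP //; apply: contra nPg => sPPg.
  by apply/normP/eqP; rewrite eq_sym eqEcard sPPg cardJg leqnn.
have iGK: #|G : K| = 5 by rewrite -divgS ?normal_sub // iK iP oG.
by apply: series_biprimary_sol nsKG _ _; rewrite ?iGK ?iK ?iP.
Qed.

Lemma solvable_card_lt60 (gT : finGroupType) (G : {group gT}) :
  (#|G| < 60)%N -> solvable G.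
Proof.
move=> ltG.
have /allP/(_ #|G|):
  all (fun n => [|| (size (primes n) <= 2)%N, n == 30 | n == 42]) (iota 0 60).
  by vm_compute.
rewrite mem_iota => /(_ ltG)/or3P[/Burnside_p_a_q_b //||] /eqP.
  exact: solvable_card30.
exact: solvable_card42.
Qed.

(** The kernel of the action on cosets lies in [H], and its quotient embeds in a symmetric group of
    order at most 24. *)
Lemma solvable_index_le4 (gT : finGroupType) (G H : {group gT}) :
  H \subset G -> (#|G : H| <= 4)%N -> solvable H -> solvable G.
Proof.
move=> sHG iHG solH; have [f kerf] := perm_rcosets_morphism sHG.
rewrite (series_sol (ker_normal f)) (solvableS kerf) //=.
rewrite (isog_sol (first_isog f)) solvable_card_lt60 //.
apply: leq_ltn_trans (max_card _) _; rewrite -cardsT card_Sym card_ord.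
by move: #|G : H| iHG; do 5?case.
Qed.

(** * Nonsolvable groups of order 60 *)

Section Order60.

Variables (gT : finGroupType) (G : {group gT}).
Hypotheses (oG : #|G| = 60) (nsolG : ~~ solvable G).

Lemma nonsolvable_card60_simple : simple G.
Proof.
apply/simpleP; split=> [|N nsNG]; first by rewrite trivg_card1 oG.
have [->|ntN] := eqVneq (gval N) 1; [by left | right].
apply/eqP; rewrite eqEcard normal_sub //= leqNgt; apply: contra nsolG => ltNG.
rewrite (series_sol nsNG) !solvable_card_lt60 -?oG //.
by rewrite ltn_quotient ?normal_sub.
Qed.

Lemma nonsolvable_card60_index (H : {group gT}) :
  H \subset G -> (#|G : H| <= 4)%N -> H :=: G.
Proof.
move=> sHG iH; apply/eqP; rewrite eqEcard sHG leqNgt; apply: contra nsolG.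
by rewrite oG => /solvable_card_lt60; apply: solvable_index_le4.
Qed.

(** The normalizer of a Sylow 2-subgroup has index 1, 3, 5 or 15. The first two would make [P]
    normal, and the third gives the claim. *)
Lemma nonsolvable_card60_index5 :
  exists2 H : {group gT}, H \subset G & #|G : H| = 5.
Proof.
have [_ simG] := simpleP _ nonsolvable_card60_simple.
have not_normal (N : {group gT}) : (1 < #|N| < 60)%N -> ~~ (N <| G).
  by move=> oN; apply/negP=> /simG[] eqN; rewrite eqN ?oG ?cards1 in oN.
have [P sylP] := Sylow_exists 2 G; have sPG := pHall_sub sylP.
have [oP iP] := card_Sylow_index sylP.
have {}iP: #|G : P| = 15 by rewrite iP oG; vm_compute.
have {}oP: #|P| = 4 by rewrite oP oG; vm_compute.
have := index_norm_Sylow_divisors _ sylP; rewrite iP => /(_ isT).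
have -> : [seq d <- divisors 15 | d == 1 %[mod 2]] = [:: 1%N; 3; 5; 15] by vm_compute.
have le4 : (#|G : 'N_G(P)| <= 4)%N -> P <| G.
  move/(nonsolvable_card60_index (subsetIl _ _)) => /= defG.
  by apply: norm_index1_normal sPG _; rewrite defG indexgg.
rewrite !inE => /or4P[]/eqP iN.
- by have := not_normal P; rewrite oP le4 ?iN // => /(_ isT).
- by have := not_normal P; rewrite oP le4 ?iN // => /(_ isT).
- by exists 'N_G(P)%G; rewrite ?subsetIl.
have defN : 'N_G(P) = P.
  apply/eqP; rewrite eq_sym eqEcard subsetI sPG normG /=.
  by rewrite -(leq_pmul2r (isT : 0 < 15)%N) -{1}iN -iP !Lagrange ?subsetIl.
have cPP: abelian P by rewrite (@card_p2group_abelian _ 2).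
(* In the case of index 15 the claim is denied, which leads to a normal Frobenius kernel of order
   15. *)
suff /existsP[H /andP[sHG /eqP iH]] :
  [exists H : {group gT}, (H \subset G) && (#|G : H| == 5)] by exists H.
apply: contraT => /existsPn no5.
suff tiP: normedTI P^# G P.
  have [|K nsKG oK] := normedTI_normal_complement _ tiP.
    by rewrite properEcard sPG oP oG.
  by have := not_normal K; rewrite oK iP nsKG => /(_ isT).
apply/normedTI_P; rewrite normD1 defN subxx setD_eq0 subG1 trivg_card1 oP.
split=> // g Gg; suff: ~~ [disjoint P^# & P^# :^ g] -> g \in 'N_G(P).
  by rewrite defN.
case/pred0Pn=> x /=; rewrite conjD1g !inE => /andP[/andP[ntx Px] /andP[_ Pgx]].
rewrite Gg /=; apply: contraT => nPg.
(* P and its conjugate are abelian, so 'C_G[x] contains both of them and its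
   index is a proper divisor of 15. *)
have Gx := subsetP sPG x Px; set L := 'C_G[x]%G.
have sPL: P \subset L by rewrite subsetI sPG sub_cent1 (subsetP cPP).
have sPgL: P :^ g \subset L.
  rewrite subsetI conj_subG //= sub_cent1; move: Pgx; apply/subsetP.
  by rewrite -abelianE abelianJ.
have sLG: L \subset G := subsetIl _ _.
have neqLP: #|G : L| != 15.
  apply: contra nPg => /eqP iL.
  suff defP: P :=: L by rewrite {2}defP.
  apply/eqP; rewrite eqEcard sPL -(leq_pmul2r (isT : 0 < 15)%N) -{1}iL -iP.
  by rewrite !Lagrange /=.
have : #|G : L| \in [:: 1%N; 3; 5; 15].
  have -> : [:: 1%N; 3; 5; 15] = divisors 15 by vm_compute.
  by rewrite -dvdn_divisors // -iP indexgS.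
have := no5 L; rewrite sLG /= => /negPf neqL5.
rewrite !inE neqL5 (negPf neqLP) /= orbF => iL.
(* Index 1 or 3 forces [L] to be [G], so the nontrivial [x] is central, against simplicity and
   nonsolvability. *)
have defG: L :=: G.
  by apply: nonsolvable_card60_index => //; case/orP: iL => /eqP->.
have Zx : x \in 'Z(G) by rewrite inE Gx -sub_cent1 -{1}defG subsetIr.
case: (simG 'Z(G)%G (center_normal G)) => /= defZ.
  by rewrite defZ inE (negPf ntx) in Zx.
by case/negP: nsolG; rewrite abelian_sol // -defZ center_abelian.
Qed.

Lemma nonsolvable_card60_isog : G \isog 'Alt_('I_5).
Proof.
have simG := nonsolvable_card60_simple.
have [H sHG iH] := nonsolvable_card60_index5.
have [f kerf] := perm_rcosets_morphism sHG; move: f kerf; rewrite iH => f kerf.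
have [_ maxG] := simpleP _ simG.
have injf: 'injm f.
  case: (maxG _ (ker_normal f)) => [->//|/= defG].
  by move: iH; rewrite (eqP (_ : H :==: G)) ?indexgg // eqEsubset sHG -defG.
have isoG : G \isog f @* G by exact: sub_isog.
have simfG : simple (f @* G) by rewrite -(isog_simple isoG).
have ofG : #|f @* G| = 60 by rewrite -(card_isog isoG).
have oAlt : #|'Alt_('I_5)| = 60.
  by apply: double_inj; rewrite -mul2n card_Alt card_ord.
have [_ maxfG] := simpleP _ simfG.
have nsAfG : (f @* G :&: 'Alt_('I_5))%G <| f @* G.
  by rewrite /normal subsetIl normsI ?normG // (subset_trans (subsetT _)) ?Alt_norm.
(* A trivial intersection would give a product set of 3600 elements in a group of order 120. *)
case: (maxfG _ nsAfG) => [/TI_cardMg|/= /setIidPl sfGA].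
  have := max_card (mem (f @* G * 'Alt_('I_5))).
  rewrite -cardsT card_Sym card_ord => le120 eq3600; move: le120.
  by rewrite eq3600 ofG oAlt.
suff <- : f @* G = 'Alt_('I_5) by [].
by apply/eqP; rewrite eqEcard sfGA ofG oAlt.
Qed.

End Order60.

(** * Criteria for supersolvability *)

Section Supersolvable.

Implicit Type gT : finGroupType.

(** The series of the quotient is pulled back to [G] and preceded by [N]; the third isomorphism
    theorem keeps its factors cyclic. *)
Lemma supersolvable_cyclic_ext gT (G N : {group gT}) :
  N <| G -> cyclic N -> supersolvable (G / N)%G -> supersolvable G.
Proof.
move=> nsNG cycN [s sP s_last].
pose lift (K : {group coset_of N}) := (coset N @*^-1 K)%G.
have lift1 : lift 1%G = N by apply: val_inj; rewrite /= cosetpre1.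
have lift_last : lift (G / N)%G = G by apply: val_inj; rewrite /= quotientGK.
exists (N :: map lift s); last first.
  by rewrite /= -[RHS]lift_last -s_last -(last_map lift) lift1.
rewrite /= normal1 nsNG sub1G /= -(isog_cyclic (quotient1_isog N)) cycN /=.
rewrite -[X in path _ X _]lift1 path_map.
apply: sub_path sP => H K /= /and4P[nsHG nsKG sHK cycKH].
rewrite -lift_last !cosetpre_normal nsHG nsKG cosetpreSK sHK /=.
have nsHK : coset N @*^-1 H <| coset N @*^-1 K.
  by rewrite cosetpre_normal (normalS sHK _ nsHG) ?normal_sub.
rewrite -(isog_cyclic (third_isog (sub_cosetpre _) (normal_cosetpre _) nsHK)).
by rewrite /= !cosetpreK.
Qed.

(** By induction on the order of [G], it suffices to find a nontrivial element of [A] that generates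
    a normal subgroup of [G]: the hypotheses pass to the quotient. *)
Lemma supersolvable_abelian_index2 gT (G A : {group gT}) :
  A \subset G -> abelian A -> (#|G : A| <= 2)%N -> supersolvable G.
Proof.
have [n] := ubnP #|G|; elim: n => // n IHn in gT G A *; rewrite ltnS => leGn.
move=> sAG cAA iGA; have [A1|ntA] := eqVneq (gval A) 1.
  exists [:: G] => //=; rewrite normal1 normal_refl sub1G /= andbT.
  rewrite -(isog_cyclic (quotient1_isog G)).
  have: (#|G| <= 2)%N by rewrite -indexg1 -A1.
  rewrite leq_eqVlt ltnS => /predU1P[oG|/card_le1_trivg->].
    by rewrite prime_cyclic ?oG.
  exact: cyclic1.
suff [x [Ax ntx nxG]] : exists x, [/\ x \in A, x != 1 & G \subset 'N(<[x]>)].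
  have sxA : <[x]> \subset A by rewrite cycle_subG.
  have nsxG : <[x]> <| G by rewrite /normal (subset_trans sxA).
  apply: (supersolvable_cyclic_ext nsxG (cycle_cyclic x)).
  apply: (IHn _ _ (A / <[x]>)%G) => /=.
  - apply: leq_trans leGn; rewrite ltn_quotient ?normal_sub //.
    by rewrite cycle_eq1.
  - exact: quotientS.
  - exact: quotient_abelian.
  apply: leq_trans iGA; apply: dvdn_leq => //.
  by rewrite index_quotient // subIset // nxG.
have normA x : x \in A -> A \subset 'N(<[x]>).
  by move=> Ax; rewrite cents_norm // cent_cycle sub_cent1 (subsetP cAA).
have [a Aa nta] : exists2 a, a \in A & a != 1 by apply/trivgPn.
have [sGA|/subsetPn[t Gt notAt]] := boolP (G \subset A).
  by exists a; rewrite (subset_trans sGA) ?normA.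
have iGA2: #|G : A| = 2.
  by apply/eqP; rewrite eqn_leq iGA indexg_gt1; apply/subsetPn; exists t.
have /andP[_ nAG] := index2_normal sAG iGA2.
(* As [A] has index 2, it generates [G] together with [t], so normality need only be tested on
   [t]. *)
have genG (L : {group gT}) : A \subset L -> t \in L -> G \subset L.
  move=> sAL Lt; have sAI : A \subset G :&: L by rewrite subsetI sAG.
  have := Lagrange_index (subsetIl G L) sAI.
  rewrite iGA2 indexgI => eq2; apply: contraT; rewrite -indexg_gt1 => gt1.
  have: (1 < #|G :&: L : A|)%N.
    by rewrite indexg_gt1; apply/subsetPn; exists t; rewrite // inE Gt.
  by move/(leq_mul gt1); rewrite eq2.
have Aat : a ^ t \in A by rewrite memJ_norm // (subsetP nAG).
(* t ^+ 2 centralizes A, so b is fixed by t, hence central in G; if b = 1, then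
   t inverts a. *)
pose b := a * a ^ t.
have [b1|ntb] := eqVneq b 1.
  exists a; split=> //; apply: genG; first exact: normA.
  have -> : t \in 'N(<[a]>) = (<[a ^ t]> == <[a]>).
    by rewrite cycleJ; apply: (sameP normP eqP).
  have -> : a ^ t = a^-1 by apply/eqP; rewrite eq_sym eq_invg_mul -/b b1.
  by rewrite cycleV.
have Ab : b \in A by rewrite groupM.
exists b; split=> //; apply: genG; first exact: normA.
rewrite (subsetP (cent_sub _)) // cent_cycle cent1C; apply/cent1P/commgP/conjg_fixP.
have At2 : t ^+ 2 \in A.
  have Nt := subsetP nAG t Gt; apply: coset_idr; first exact: groupX.
  by rewrite morphX // -iGA2 -card_quotient // expg_cardG ?mem_quotient.
rewrite conjMg -conjgM.
have -> : a ^ (t * t) = a by apply/conjg_fixP/commgP; exact: (centsP cAA).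
exact: (centsP cAA).
Qed.

(** A nontrivial center allows induction through a central cyclic subgroup. Otherwise [G] has order
    at most 8; a [p]-group with trivial center is trivial, which leaves order 6. *)
Lemma supersolvable_index_center_le8 gT (G : {group gT}) :
  (#|G : 'Z(G)| <= 8)%N -> supersolvable G.
Proof.
have [n] := ubnP #|G|; elim: n => // n IHn in gT G *; rewrite ltnS => leGn iZ.
have [Z1|ntZ] := eqVneq 'Z(G) 1; last first.
  have [z Zz ntz] : exists2 z, z \in 'Z(G) & z != 1 by apply/trivgPn.
  have szZ : <[z]> \subset 'Z(G) by rewrite cycle_subG.
  have nszG := sub_center_normal szZ.
  apply: (supersolvable_cyclic_ext nszG (cycle_cyclic z)); apply: IHn => /=.
    by apply: leq_trans leGn; rewrite ltn_quotient ?normal_sub ?cycle_eq1.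
  have sZ : 'Z(G) / <[z]> \subset 'Z(G / <[z]>).
    by rewrite subsetI quotientS ?center_sub // quotient_cents // subsetIr.
  apply: leq_trans iZ; apply: leq_trans (dvdn_leq _ (indexgS _ sZ)) _ => //.
  by rewrite index_quotient_eq ?center_sub ?normal_norm // (subset_trans (subsetIr _ _)).
have oG : (#|G| <= 8)%N by rewrite -indexg1 -Z1.
have p_case (p : nat) : p.-group G -> supersolvable G.
  move=> pG; apply: (@supersolvable_abelian_index2 _ _ G) => //.
    by rewrite (trivg_center_pgroup pG Z1) abelian1.
  by rewrite indexgg.
have /allP/(_ #|G|) :
  all (fun n => [|| n == 6, 2.-nat n, 3.-nat n, 5.-nat n | 7.-nat n]) (iota 1 8).
  by vm_compute.
rewrite mem_iota => /(_ _)/or4P; rewrite cardG_gt0 ltnS oG => /(_ isT).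
case=> [/eqP o6|/p_case//|/p_case//|/orP[]/p_case//].
have [P sylP] := Sylow_exists 3 G; have [oP iP] := card_Sylow_index sylP.
apply: (@supersolvable_abelian_index2 _ _ P); first exact: pHall_sub sylP.
  by rewrite cyclic_abelian // prime_cyclic // oP o6.
by rewrite iP o6.
Qed.

End Supersolvable.

(** * Groups with a center or an abelian subgroup of small index *)

Section CentralIndex.

Variable gT : finGroupType.
Implicit Types G H M A : {group gT}.

(** Both Sylow subgroups are normal, so they commute and their product is cyclic. *)
Lemma cyclic_card15 G : #|G| = 15 -> cyclic G.
Proof.
move=> oG; have [[P sylP] [Q sylQ]] := (Sylow_exists 5 G, Sylow_exists 3 G).
have [[oP iP] [oQ iQ]] := (card_Sylow_index sylP, card_Sylow_index sylQ).
have {}oP : #|P| = 5 by rewrite oP oG; vm_compute.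
have {}oQ : #|Q| = 3 by rewrite oQ oG; vm_compute.
have {}iP : #|G : P| = 3 by rewrite iP oG; vm_compute.
have {}iQ : #|G : Q| = 5 by rewrite iQ oG; vm_compute.
have coPQ : coprime #|P| #|Q| by rewrite oP oQ.
have nsPG : P <| G.
  apply: norm_index1_normal (pHall_sub sylP) _; apply/eqP.
  have := index_norm_Sylow_divisors _ sylP; rewrite iP => /(_ isT).
  have -> : [seq d <- divisors 3 | d == 1 %[mod 5]] = [:: 1%N] by vm_compute.
  by rewrite inE.
have nsQG : Q <| G.
  apply: norm_index1_normal (pHall_sub sylQ) _; apply/eqP.
  have := index_norm_Sylow_divisors _ sylQ; rewrite iQ => /(_ isT).
  have -> : [seq d <- divisors 5 | d == 1 %[mod 3]] = [:: 1%N] by vm_compute.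
  by rewrite inE.
suff <- : P * Q = G.
  apply: cyclicM; rewrite ?prime_cyclic ?oP ?oQ //.
  apply/commG1P/trivgP; rewrite -(coprime_TIg coPQ) subsetI.
  rewrite commg_subl commg_subr; apply/andP.
  split; first exact: subset_trans (normal_sub nsQG) (normal_norm nsPG).
  exact: subset_trans (normal_sub nsPG) (normal_norm nsQG).
apply/eqP; rewrite eqEcard mul_subG ?normal_sub //=.
by rewrite coprime_cardMg // oP oQ oG.
Qed.

Lemma card_center_quotient G : #|G / 'Z(G)| = #|G : 'Z(G)|.
Proof. by rewrite card_quotient ?normal_norm ?center_normal. Qed.

Lemma index_center_lt4_abelian G : (#|G : 'Z(G)| < 4)%N -> abelian G.
Proof.
rewrite -card_center_quotient => ltZ; apply: cyclic_center_factor_abelian.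
have [/prime_cyclic//|] := boolP (prime #|G / 'Z(G)|).
have [/card1_trivg->|] := eqVneq #|G / 'Z(G)| 1%N; first by rewrite cyclic1.
by have := cardG_gt0 (G / 'Z(G)); move: #|_| ltZ; do 4?case.
Qed.

Lemma index_center_lt60_sol G : (#|G : 'Z(G)| < 60)%N -> solvable G.
Proof.
rewrite -card_center_quotient => /solvable_card_lt60 solGZ.
by rewrite (series_sol (center_normal G)) solGZ abelian_sol ?center_abelian.
Qed.

Lemma abelian_index_le7_sol G M :
  M \subset G -> abelian M -> (#|G : M| <= 7)%N -> solvable G.
Proof.
move=> sMG cMM iM; have [nMG|/subsetPn[x Gx nMx]] := boolP (G \subset 'N(M)).
  rewrite (@series_sol _ G M) /normal ?sMG // abelian_sol //=.
  by rewrite solvable_card_lt60 // card_quotient // (leq_ltn_trans iM).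
have neqMx : M :^ x != M by apply: contra nMx => /eqP/normP.
pose L := (M <*> M :^ x)%G.
have sMxG : M :^ x \subset G by rewrite conj_subG.
have sML : M \subset L := joing_subl _ _.
have sLG : L \subset G by rewrite join_subG sMG.
have sIZ : M :&: M :^ x \subset 'Z(L).
  rewrite subsetI (subset_trans (subsetIl _ _) sML) /= centY subsetI.
  have cMxMx : abelian (M :^ x) by rewrite abelianJ.
  by rewrite (subset_trans (subsetIl _ _) cMM) (subset_trans (subsetIr _ _) cMxMx).
have [sGL|not_sGL] := boolP (G \subset L).
  have defG : L :=: G by apply/eqP; rewrite eqEsubset sLG.
  apply: index_center_lt60_sol; rewrite -defG.
  have le_dvd := dvdn_leq _ (indexgS L sIZ); apply: leq_ltn_trans (le_dvd _) _ => //.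
  suff: (#|L : M :&: M :^ x| <= 7 ^ 2)%N by move/leq_ltn_trans; apply.
  (* The product set of [M] and [M :^ x] fits in [G], so their intersection has index at most the
     square of that of [M]. *)
  have cMI : (#|M| ^ 2 <= #|G| * #|M :&: M :^ x|)%N.
    rewrite -mulnn -{2}(cardJg M x) mul_cardG leq_mul2r subset_leq_card ?orbT //.
    by rewrite mul_subG.
  have sIG : M :&: M :^ x \subset G by rewrite subIset ?sMG.
  rewrite defG -(leq_pmul2l (cardG_gt0 (M :&: M :^ x))) Lagrange //.
  rewrite -(leq_pmul2l (cardG_gt0 G)) mulnA.
  rewrite -{1 2}(Lagrange sMG) mulnn expnMn leq_mul // leq_exp2r //.
have ltML : ~~ (L \subset M).
  rewrite join_subG subxx /=; apply: contra neqMx => sMxM.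
  by rewrite eqEcard sMxM cardJg leqnn.
move: not_sGL ltML; rewrite -!indexg_gt1 => gtGL gtLM.
have iGM := Lagrange_index sLG sML.
(* The bound 4 is the one that [solvable_index_le4] requires for each of the two steps from [M] to
   [L] and from [L] to [G]. *)
have le3 (a b c : nat) : (1 < b -> a * b = c -> c <= 7 -> a <= 4)%N.
  move=> b1 <- le7; rewrite leqNgt; apply/negP => a4.
  by have := leq_trans (leq_mul a4 b1) le7.
apply: solvable_index_le4 sLG (le3 _ _ _ gtLM iGM iM) _.
apply: solvable_index_le4 sML (le3 _ _ _ gtGL _ iM) (abelian_sol cMM).
by rewrite mulnC.
Qed.

End CentralIndex.

(** * Subgroups attaining the Chermak-Delgado measure *)

Section ChermakDelgado.

Variable gT : finGroupType.
Implicit Types G H M A : {group gT}.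

Lemma cd_max_ge G H : H \subset G -> (#|H| * #|'C_G(H)| <= cd_max G)%N.
Proof. exact: (leq_bigmax_cond (F := cd_measure G)). Qed.

Lemma cd_max_ge_abelian G A :
  A \subset G -> abelian A -> (#|A| ^ 2 <= cd_max G)%N.
Proof.
move=> sAG cAA; apply: leq_trans (cd_max_ge sAG).
by rewrite -mulnn leq_mul2l subset_leq_card ?orbT // subsetI sAG.
Qed.

Lemma cd_max_attained G :
  exists M : {group gT},
    [/\ M \subset G, 'C_G(M) \subset M & cd_max G = (#|M| * #|'C_G(M)|)%N].
Proof.
pose sub_G := [pred H : {group gT} | H \subset G].
have [|H /= sHG maxH] := @eq_bigmax_cond _ sub_G (cd_measure G).
  by apply/card_gt0P; exists G; rewrite inE /=.
rewrite inE in sHG; have cHK : 'C_G(H) \subset 'C(H) := subsetIr _ _.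
have sMG : H <*> 'C_G(H) \subset G by rewrite join_subG sHG subsetIl.
exists (H <*> 'C_G(H))%G; split=> //.
  by rewrite (subset_trans _ (joing_subr _ _)) // setIS // centS // joing_subl.
apply/eqP; rewrite eqn_leq cd_max_ge // andbT.
(* Cancelling the order of the product set leaves the order of [H :&: 'C_G(H)] to be bounded by that
   of the centralizer of the join. *)
rewrite [cd_max G]maxH /cd_measure mul_cardG /= cent_joinEr // leq_mul2l.
apply/orP; right; apply: subset_leq_card; rewrite centM subsetI.
rewrite (subset_trans (subsetIl _ _) sHG) /= subsetI subIset; last first.
  by rewrite cHK orbT.
by rewrite subIset // centsC cHK.
Qed.

Lemma cd_max_index G :
  exists M : {group gT},
    [/\ M \subset G, 'C_G(M) = 'Z(M)
      & (#|G : M| ^ 2 * #|M : 'Z(M)| * cd_max G = #|G| ^ 2)%N].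
Proof.
have [M [sMG sCM ->]] := cd_max_attained G; exists M.
have defC : 'C_G(M) = 'Z(M).
  apply/eqP; rewrite eqEsubset; apply/andP; split; last exact: setSI.
  by rewrite subsetI sCM subsetIr.
split=> //; rewrite defC -(Lagrange sMG) expnMn.
by rewrite -{1 2}(Lagrange (center_sub M)); ring.
Qed.

Lemma cd_ratio_inv G n :
  (0 < n)%N -> (n * cd_max G = #|G| ^ 2)%N -> cd_ratio G = (1 / n%:R)%R.
Proof.
move=> n0 eqn; have cd0 : (0 < cd_max G)%N.
  by have := cardG_gt0 G; rewrite -sqrn_gt0 -eqn muln_gt0 => /andP[].
rewrite /cd_ratio -eqn natrM invfM mulrCA divff ?mulr1 ?div1r //.
by rewrite pnatr_eq0 -lt0n.
Qed.

Lemma self_centralizing_abelian G H : self_centralizing G H -> abelian H.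
Proof. by case/andP=> _ /eqP defH; rewrite /abelian -{1}defH subsetIr. Qed.

(** The centralizer lies between [A] and [G], so by primality it is one of them; if it were [G],
    then [A] would be central. *)
Lemma prime_index_self_centralizing G A :
    A \subset G -> abelian A -> prime #|G : A| -> ~~ (A \subset 'Z(G)) ->
  self_centralizing G A.
Proof.
move=> sAG cAA p_pr; apply: contraR; rewrite /self_centralizing sAG eqEsubset.
have sAC : A \subset 'C_G(A) by rewrite subsetI sAG.
rewrite sAC andbT -indexg_gt1 /= => gt1.
have := Lagrange_index (subsetIl G 'C(A)) sAC => eq_p.
have iCA : #|'C_G(A) : A| = #|G : A|.
  apply/(prime_nt_dvdP p_pr); first by rewrite gtn_eqF.
  by rewrite -eq_p dvdn_mull.
move/eqP: eq_p; rewrite iCA -[X in _ == X]mul1n.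
rewrite eqn_pmul2r ?prime_gt0 // indexg_eq1 subsetI subxx => cAG.
by rewrite subsetI sAG centsC.
Qed.

(** The preimage of [B] is abelian as a central extension of a cyclic group. *)
Lemma abelian_cosetpre_center G (B : {group coset_of 'Z(G)}) :
    B \subset G / 'Z(G) -> cyclic B ->
  exists A : {group gT}, [/\ A \subset G, abelian A & #|A| = (#|'Z(G)| * #|B|)%N].
Proof.
move=> sBG cycB; exists (coset 'Z(G) @*^-1 B)%G; rewrite card_cosetpre.
have sAG : coset 'Z(G) @*^-1 B \subset G by rewrite sub_cosetpre_quo ?center_normal.
split=> //; apply: (@cyclic_factor_abelian _ 'Z(G)); last by rewrite cosetpreK.
by rewrite subsetI sub_cosetpre subIset // orbC centS.
Qed.

(** Cauchy's theorem gives a subgroup of order [p] of the central quotient; its preimage is abelian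
    of index [p], and too large to be central. *)
Lemma index_center_prime_sqr G p :
    prime p -> #|G : 'Z(G)| = (p ^ 2)%N ->
  exists H : {group gT}, self_centralizing G H /\ #|G : H| = p.
Proof.
move=> p_pr iZ; have p0 := prime_gt0 p_pr.
have [|x Gx ox] := @Cauchy _ p (G / 'Z(G))%G p_pr.
  by rewrite card_center_quotient iZ dvdn_exp.
have [||A [sAG cAA oA]] := @abelian_cosetpre_center G <[x]>%G.
- by rewrite cycle_subG.
- exact: cycle_cyclic.
have iA : #|G : A| = p.
  apply/eqP; rewrite -(eqn_pmul2l (cardG_gt0 A)) Lagrange //.
  by rewrite -(Lagrange (center_sub G)) iZ oA -orderE ox -mulnA mulnn.
exists A; split=> //; apply: prime_index_self_centralizing; rewrite ?iA //.
apply/negP => /subset_leq_card; apply/negP; rewrite -ltnNge oA -orderE ox.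
by rewrite ltn_Pmulr ?prime_gt1.
Qed.

End ChermakDelgado.

(** * Arithmetic of the inverse ratio *)

Lemma ltr_invn (m n : nat) :
  (0 < m)%N -> (0 < n)%N -> ((1 / m%:R < 1 / n%:R :> rat) = (n < m)%N)%R.
Proof. by move=> m0 n0; rewrite !div1r ltf_pV2 ?posrE ?ltr0n // ltr_nat. Qed.

Lemma eqr_invn (m n : nat) : (1 / m%:R = 1 / n%:R :> rat)%R <-> m = n.
Proof.
by rewrite !div1r; split=> [/invr_inj/eqP|-> //]; rewrite eqr_nat => /eqP.
Qed.

Lemma leq_sqr_mul (d e k : nat) :
  (0 < d ^ 2 * e -> d ^ 2 * e < k ^ 2 -> d < k)%N.
Proof.
rewrite muln_gt0 => /andP[_ e0] lt_k; rewrite -(ltn_exp2r _ _ (isT : 0 < 2)%N).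
exact: leq_ltn_trans (leq_pmulr _ e0) lt_k.
Qed.

Lemma sqr_mul9 (d e : nat) :
  (d ^ 2 * e = 9)%N -> d = 1%N \/ d = 3 /\ e = 1%N.
Proof.
move=> de9; have := @leq_sqr_mul d e 4; rewrite de9 => /(_ isT isT).
by move: de9; do 4?[case: d => [|d]] => // de9 _; rewrite ?expnS in de9; lia.
Qed.

Lemma sqr_mul60 (d e : nat) :
  (d ^ 2 * e = 60)%N -> d = 1%N \/ d = 2 /\ e = 15.
Proof.
move=> de60; have := @leq_sqr_mul d e 8; rewrite de60 => /(_ isT isT).
by move: de60; do 8?[case: d => [|d]] => // de60 _; rewrite ?expnS in de60; lia.
Qed.

(** * The three thresholds 4, 9 and 60 *)

Section CentralizingMaximizer.

Variables (gT : finGroupType) (G M : {group gT}).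
Hypotheses (sMG : M \subset G) (defC : 'C_G(M) = 'Z(M)).

(** By [cdM], this natural number is the inverse of [cd_ratio G]. *)
Let n := (#|G : M| ^ 2 * #|M : 'Z(M)|)%N.
Hypothesis cdM : (n * cd_max G = #|G| ^ 2)%N.

Let e_gt0 : (0 < #|M : 'Z(M)|)%N := indexg_gt0 _ _.
Let d_gt0 : (0 < #|G : M|)%N := indexg_gt0 _ _.

Let abelian_self_centralizing : abelian M -> self_centralizing G M.
Proof. by move=> cMM; rewrite /self_centralizing sMG defC (center_idP cMM) eqxx. Qed.

Lemma cd_index_abelian_lt4 : (n < 4)%N -> abelian G.
Proof.
move=> n4; have d1 : #|G : M| = 1%N by rewrite /n in n4; nia.
rewrite -(index1g sMG d1); apply: index_center_lt4_abelian.
by rewrite /n d1 mul1n in n4.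
Qed.

(** Forward, the pairs are (1, 4) and (2, 1). Conversely, the measure of an abelian subgroup of
    index 2 gives [n <= 4], and a smaller [n] would make [G] abelian and so centralize [H]. *)
Lemma cd_index_eq4 :
  n = 4 <-> exists H : {group gT}, self_centralizing G H /\ #|G : H| = 2.
Proof.
split=> [n4 | [H [scH iH]]].
  have [d1|d1] := eqVneq #|G : M| 1%N.
    apply: index_center_prime_sqr => //.
    by rewrite -(index1g sMG d1) -[RHS]n4 /n d1 mul1n.
  have [d2 e1] : #|G : M| = 2 /\ #|M : 'Z(M)| = 1%N by rewrite /n in n4; nia.
  exists M; split=> //; apply/abelian_self_centralizing/index_center_lt4_abelian.
  by rewrite e1.
have [sHG /eqP defH] := andP scH.
have le_cd := cd_max_ge_abelian sHG (self_centralizing_abelian scH).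
have n4 : (n <= 4)%N.
  have := cdM; rewrite -(Lagrange sHG) iH.
  have := cardG_gt0 H; nia.
apply/eqP; rewrite eqn_leq n4 leqNgt; apply/negP => /cd_index_abelian_lt4 cGG.
have : (2 <= #|G : H|)%N by rewrite iH.
by rewrite indexg_gt1 -defH subsetI subxx (subset_trans cGG) ?centS.
Qed.

Lemma cd_index_supersolvable_lt9 : (n < 9)%N -> supersolvable G.
Proof.
rewrite /n => n9; have [d1|d1] := eqVneq #|G : M| 1%N.
  apply: supersolvable_index_center_le8; rewrite -(index1g sMG d1).
  by rewrite d1 mul1n in n9.
have [d2 e2] : #|G : M| = 2 /\ (#|M : 'Z(M)| < 4)%N by nia.
apply: supersolvable_abelian_index2 sMG _ _; last by rewrite d2.
exact: index_center_lt4_abelian.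
Qed.

Lemma cd_index_eq9 :
  n = 9 -> exists H : {group gT}, self_centralizing G H /\ #|G : H| = 3.
Proof.
rewrite /n => n9; have [d1|[d3 e1]] := sqr_mul9 n9.
  apply: index_center_prime_sqr => //.
  by rewrite -(index1g sMG d1) -[RHS]n9 d1 mul1n.
exists M; split=> //; apply/abelian_self_centralizing/index_center_lt4_abelian.
by rewrite e1.
Qed.

Lemma cd_index_solvable_lt60 : (n < 60)%N -> solvable G.
Proof.
rewrite /n => n60; have [d4|d4] := leqP #|G : M| 4.
  apply: solvable_index_le4 sMG d4 (index_center_lt60_sol _); nia.
(* Here 60 is less than the square of 8. *)
have d7 : (#|G : M| < 8)%N.
  by apply: leq_sqr_mul (leq_trans n60 _) => //; rewrite muln_gt0 sqrn_gt0 d_gt0.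
have e2 : (#|M : 'Z(M)| < 4)%N.
  rewrite -(ltn_pmul2l (isT : 0 < 5 ^ 2)%N); apply: leq_ltn_trans (leq_trans n60 _) => //.
  by rewrite leq_mul2r leq_sqr d4 orbT.
exact: abelian_index_le7_sol sMG (index_center_lt4_abelian e2) d7.
Qed.

Lemma cd_index_eq60 : n = 60 <-> G / 'Z(G) \isog 'Alt_('I_5).
Proof.
split=> [n60 | isoA].
  have d1 : #|G : M| = 1%N.
    have [//|[d2 e15]] := sqr_mul60 n60.
    have : #|M : 'Z(M)| = 1%N.
      rewrite (center_idP _) ?indexgg //; apply: cyclic_center_factor_abelian.
      by rewrite cyclic_card15 // card_center_quotient.
    by rewrite e15.
  have defG := index1g sMG d1.
  have iZ : #|G : 'Z(G)| = 60 by rewrite -defG -[RHS]n60 /n d1 mul1n.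
  apply: nonsolvable_card60_isog; first by rewrite card_center_quotient.
  apply/negP => solGZ; have [Q hallQ] := Hall_exists 2^' solGZ.
  have oQ : #|Q| = 15.
    apply/eqP; rewrite -(eqn_pmul2l (isT : 0 < 2 ^ logn 2 60)%N) -{1}iZ.
    rewrite -card_center_quotient -p_part (card_Hall hallQ) partnC ?cardG_gt0 //.
    by rewrite card_center_quotient iZ.
  have [A [sAG cAA oA]] := abelian_cosetpre_center (pHall_sub hallQ) (cyclic_card15 oQ).
  (* With z the order of the center, the square of the order of [A] is 225 z^2, while [cd_max G] is
     only 60 z^2. *)
  have := cd_max_ge_abelian sAG cAA; rewrite oA oQ leqNgt => /negP[].
  have oG := Lagrange (center_sub G); have z0 := cardG_gt0 'Z(G).
  rewrite -(ltn_pmul2l (isT : 0 < 60)%N) -[X in (X * _ < _)%N]n60 cdM -oG iZ.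
  by rewrite !expnMn mulnCA ltn_pmul2l ?sqrn_gt0.
have oGZ : #|G : 'Z(G)| = 60.
  rewrite -card_center_quotient (card_isog isoA).
  by apply: double_inj; rewrite -mul2n card_Alt card_ord.
(* The measure of [G] itself bounds [n] by the index of the center; a smaller [n] would make [G]
   solvable, unlike its quotient. *)
have n60 : (n <= 60)%N.
  rewrite -(@leq_pmul2r (#|G| * #|'Z(G)|)) ?muln_gt0 ?cardG_gt0 //.
  apply: (@leq_trans (n * cd_max G)).
    by rewrite leq_mul2l (cd_max_ge (subxx G)) orbT.
  by rewrite cdM mulnCA -oGZ [(#|G : _| * _)%N]mulnC Lagrange ?center_sub // mulnn.
apply/eqP; rewrite eqn_leq n60 leqNgt; apply/negP => /cd_index_solvable_lt60 solG.
have := quotient_sol 'Z(G) solG.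
by rewrite (isog_sol isoA) solvable_AltF // card_ord.
Qed.

End CentralizingMaximizer.

Local Open Scope ring_scope.

Theorem theorem1p1 (gT : finGroupType) (G : {group gT}) :
  [/\ (1 / 4 < cd_ratio G -> abelian G) /\
      (cd_ratio G = 1 / 4 <->
       exists H : {group gT}, self_centralizing G H /\ #|G : H|%g = 2%N),
      (1 / 9 < cd_ratio G -> supersolvable G) /\
      (cd_ratio G = 1 / 9 ->
       exists H : {group gT}, self_centralizing G H /\ #|G : H|%g = 3%N)
    & (1 / 60 < cd_ratio G -> solvable G) /\
      (cd_ratio G = 1 / 60 <-> (G / 'Z(G))%g \isog 'Alt_('I_5)) ].
Proof.
have [M [sMG defC cdM]] := cd_max_index G.
have n_gt0 : (0 < #|G : M| ^ 2 * #|M : 'Z(M)|)%N.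
  by rewrite muln_gt0 sqrn_gt0 !indexg_gt0.
rewrite (cd_ratio_inv n_gt0 cdM) !ltr_invn //.
split; split.
- exact: cd_index_abelian_lt4.
- exact: iff_trans (eqr_invn _ 4) (cd_index_eq4 sMG defC cdM).
- exact: cd_index_supersolvable_lt9.
- by move/eqr_invn/cd_index_eq9; apply.
- exact: cd_index_solvable_lt60.
exact: iff_trans (eqr_invn _ 60) (cd_index_eq60 sMG defC cdM).
Qed.
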